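(* Every graph $G$ with $cr(G)\leq 10$ is biplanar.
   Context: $cr(G)$ denotes the minimum number of edge crossings over all drawings of $G$ in the plane (simple drawings: no two edges cross more than once, no three edges cross at a point). A graph $G=(V,E)$ is biplanar if there is a partition $E=E_1\cup E_2$, $E_1\cap E_2=\emptyset$, such that both $G_1=(V,E_1)$ and $G_2=(V,E_2)$ are planar. *)

(* Defs.v *)
From mathcomp Require Import all_boot.
From Stdlib Require Import Reals.

Set Implicit Arguments.
Unset Strict Implicit.
Unset Printing Implicit Defensive.

Definition point := (R * R)%type.

(* A map R -> R^2 is continuous (componentwise, equivalently for the
   Euclidean topology).  A curve on [0,1] is represented by a continuous
   map on all of R (any continuous map on [0,1] extends continuously). *)
Definition path_cont (g : R -> point) : Prop :=
  forall t : R, continuity_pt (fun s => fst (g s)) t /\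
                continuity_pt (fun s => snd (g s)) t.

Definition is_drawing (T : finType) (e : rel T)
    (p : T -> point) (g : T -> T -> R -> point) : Prop :=
  injective p /\
  forall u v : T, e u v ->
    [/\ path_cont (g u v),
        g u v 0%R = p u /\
        g u v 1%R = p v,
        (forall s t : R, (0 <= s <= 1)%R -> (0 <= t <= 1)%R ->
            g u v s = g u v t -> s = t),
        (forall t : R, (0 < t < 1)%R -> forall w : T, g u v t <> p w)
      & (forall t : R, g v u t = g u v (1 - t)%R)].

Definition on_int (T : Type) (g : T -> T -> R -> point) (u v : T) (q : point)
  : Prop := exists t : R, (0 < t < 1)%R /\ g u v t = q.

Definition simple_drawing (T : finType) (e : rel T)
    (g : T -> T -> R -> point) : Prop :=
  (forall u v x y : T, e u v -> e x y -> [set u; v] != [set x; y] ->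
     forall q q' : point,
       on_int g u v q -> on_int g x y q ->
       on_int g u v q' -> on_int g x y q' -> q = q') /\
  (forall u1 v1 u2 v2 u3 v3 : T, e u1 v1 -> e u2 v2 -> e u3 v3 ->
     [set u1; v1] != [set u2; v2] -> [set u1; v1] != [set u3; v3] ->
     [set u2; v2] != [set u3; v3] ->
     forall q : point, on_int g u1 v1 q -> on_int g u2 v2 q ->
       on_int g u3 v3 q -> False).

(* cr(G) <= k : there is a simple drawing of G in which the set of
   (unordered) pairs of distinct edges that cross has at most k elements.
   Edges are represented as 2-element vertex sets. *)
Definition cr_le (T : finType) (e : rel T) (k : nat) : Prop :=
  exists (p : T -> point) (g : T -> T -> R -> point),
    [/\ is_drawing e p g, simple_drawing e g &
      exists C : {set {set {set T}}},
        (#|C| <= k)%N /\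
        (forall u v x y : T, e u v -> e x y -> [set u; v] != [set x; y] ->
           (exists q : point, on_int g u v q /\ on_int g x y q) ->
           [set [set u; v]; [set x; y]] \in C)].

Definition planar (T : finType) (e : rel T) : Prop := cr_le e 0.

Definition biplanar (T : finType) (e : rel T) : Prop :=
  exists c : T -> T -> bool,
    (forall u v : T, c u v = c v u) /\
    planar [rel u v | e u v && c u v] /\
    planar [rel u v | e u v && ~~ c u v].

(* Main.v *)
Require Import Defs.
From mathcomp Require Import all_boot zify.
From Stdlib Require Import Reals Lra Classical.

Set Implicit Arguments.
Unset Strict Implicit.
Unset Printing Implicit Defensive.

(** Let H be the crossing graph: its vertices are the edges of G and its edges
    are the at most 10 crossing pairs.  If H is bipartite, its colour classes are
    drawn without crossings.  Otherwise let F be a vertex cover of H: the edges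
    outside F are drawn without crossings, so it suffices that F, as an abstract
    graph, is planar.  Every graph with at most 8 edges is planar, indeed it has a
    two-page book embedding: such embeddings extend over a new leaf and, under a
    mild condition, over a new vertex of degree 2, and a graph with at most 8 edges
    in which neither reduction applies has at most 6 non-isolated vertices.
    A nonbipartite H has a cover of size 8, unless it consists of a triangle and 7
    isolated edges; then there is a cover of size 9 which is a graph with a leaf. *)

(** A two-page book embedding: the vertices lie on a line in the order given by
    [pos], and two edges on the same side [c] of the line do not interleave. *)
Definition book (T : finType) (F : {set {set T}}) : Prop :=
  exists (pos : T -> nat) (c : {set T} -> bool), injective pos /\
    forall u v x y, [set u; v] \in F -> [set x; y] \in F ->
      c [set u; v] = c [set x; y] ->
      pos u < pos x -> pos x < pos v -> pos v < pos y -> False.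

Lemma set2_eqP (T : finType) (u v x y : T) :
  [set u; v] = [set x; y] -> (u = x /\ v = y) \/ (u = y /\ v = x).
Proof.
move=> E.
have: u \in [set x; y] by rewrite -E set21.
have: v \in [set x; y] by rewrite -E set22.
have: x \in [set u; v] by rewrite E set21.
have: y \in [set u; v] by rewrite E set22.
rewrite !inE => /orP[] /eqP Hy /orP[] /eqP Hx /orP[] /eqP Hv /orP[] /eqP Hu;
  subst; auto.
Qed.

Lemma set2_of_mem (T : finType) (A : {set T}) v : #|A| = 2 -> v \in A ->
  exists2 a, v != a & A = [set v; a].
Proof.
move=> /eqP/cards2P[x [y [ne ->]]]; rewrite !inE => /orP[] /eqP ->.
  by exists y.
by exists x; rewrite 1?eq_sym // setUC.
Qed.

Lemma triangle_neq (T : finType) (a b c : T) : a != b -> a != c -> b != c ->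
  [/\ [set a; b] != [set a; c], [set a; b] != [set b; c] & [set a; c] != [set b; c]].
Proof.
move=> ab ac bc; split; apply/eqP => /set2_eqP[] [E1 E2];
  by move: ab ac bc; rewrite ?E1 ?E2 ?eqxx.
Qed.

(** * Parabolic arcs over a line *)

Section Arcs.
Local Open Scope R_scope.

(** In terms of the first coordinate [x] the height is [s * (x - a) * (b - x)]. Hence the sign [s]
    picks the half-plane, and exchanging [a] and [b] only reverses the arc. *)
Definition arc (a b s t : R) : point :=
  (a + t * (b - a), s * (t * (1 - t)) * ((b - a) * (b - a))).

Lemma arc_rev a b s t : arc b a s t = arc a b s (1 - t).
Proof. by rewrite /arc; congr pair; ring. Qed.

Lemma arc_cont a b s : path_cont (arc a b s).
Proof. by move=> t; split; rewrite /arc /=; reg. Qed.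

(** Overlapping intervals that do not interleave are nested; unless they coincide, the product at
    [x] is strictly larger for the larger one. *)
Lemma parabolas_meet (a b c d x : R) :
  a < x < b -> c < x < d -> (x - a) * (b - x) = (x - c) * (d - x) ->
  ~ (a < c /\ c < b /\ b < d) -> ~ (c < a /\ a < d /\ d < b) ->
  a = c /\ b = d.
Proof.
move=> hx hx' E n1 n2.
case: (Rtotal_order a c) => [lt|[eq|gt]].
- have h : d <= b by apply: Rnot_lt_le => h; apply: n1; lra.
  exfalso; nra.
- split=> //; subst c.
  have := Rmult_eq_reg_l _ _ _ E; lra.
- have h : b <= d by apply: Rnot_lt_le => h; apply: n2; lra.
  exfalso; nra.
Qed.

Lemma arcs_meet_incr (a b c d s s' t t' : R) :
  a < b -> c < d -> s = 1 \/ s = -1 -> s' = 1 \/ s' = -1 ->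
  0 < t < 1 -> 0 < t' < 1 -> arc a b s t = arc c d s' t' ->
  (s = s' -> ~ (a < c /\ c < b /\ b < d)) ->
  (s = s' -> ~ (c < a /\ a < d /\ d < b)) ->
  a = c /\ b = d.
Proof.
move=> ab cd hs hs' ht ht' [Ex Ey] n1 n2.
set x := a + t * (b - a) in Ex.
have xa : x - a = t * (b - a) by rewrite /x; ring.
have xb : b - x = (1 - t) * (b - a) by rewrite /x; ring.
have xc : x - c = t' * (d - c) by rewrite Ex; ring.
have xd : d - x = (1 - t') * (d - c) by rewrite Ex; ring.
have p1 : 0 < t * (b - a) by apply: Rmult_lt_0_compat; lra.
have p2 : 0 < (1 - t) * (b - a) by apply: Rmult_lt_0_compat; lra.
have p3 : 0 < t' * (d - c) by apply: Rmult_lt_0_compat; lra.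
have p4 : 0 < (1 - t') * (d - c) by apply: Rmult_lt_0_compat; lra.
have E : s * ((x - a) * (b - x)) = s' * ((x - c) * (d - x)).
  by rewrite xa xb xc xd; lra.
have q1 : 0 < (x - a) * (b - x) by rewrite xa xb; apply: Rmult_lt_0_compat.
have q2 : 0 < (x - c) * (d - x) by rewrite xc xd; apply: Rmult_lt_0_compat.
(* The heights have the signs of [s] and [s'], so arcs that meet lie on the same side. *)
have ss : s = s' by case: hs => ?; case: hs' => ?; subst; lra.
apply: (@parabolas_meet a b c d x); try lra; auto.
by subst s'; case: hs => ?; subst; lra.
Qed.

End Arcs.

(** * Drawing book embeddings, and extending them by vertices of degree 1 and 2 *)

Section Planar.
Variable T : finType.
Implicit Types (F : {set {set T}}).

(** The vertices go on the horizontal axis at abscissae [pos u], the two pages into the upper and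
    lower half-planes, and each edge becomes a parabolic arc. *)
Lemma book_planar (r : rel T) F :
  irreflexive r -> (forall u v, r u v -> [set u; v] \in F) ->
  book F -> planar r.
Proof.
move=> irr rF [pos [c [pos_inj noint]]].
pose X u := INR (pos u).
pose s u v := if c [set u; v] then 1%R else (-1)%R.
pose g u v := arc (X u) (X v) (s u v).
have s1 u v : s u v = 1%R \/ s u v = (-1)%R by rewrite /s; case: ifP; auto.
have sC u v : s u v = s v u by rewrite /s setUC.
have X_inj : injective X by move=> u v /INR_eq /pos_inj.
have neX u v : r u v -> X u <> X v by move=> ruv /X_inj E; rewrite E irr in ruv.
have gC u v t : g v u t = g u v (1 - t)%R by rewrite /g sC arc_rev.
have sgn u v x y : s u v = s x y -> c [set u; v] = c [set x; y].
  by rewrite /s; case: ifP; case: ifP => //; lra.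
have key u v x y t t' : (X u < X v)%R -> (X x < X y)%R ->
    [set u; v] \in F -> [set x; y] \in F ->
    (0 < t < 1)%R -> (0 < t' < 1)%R -> g u v t = g x y t' ->
    [set u; v] = [set x; y].
  move=> uv xy Fuv Fxy ht ht' E.
  have [] := arcs_meet_incr uv xy (s1 u v) (s1 x y) ht ht' E.
  - move=> /sgn cc [/INR_lt h1 [/INR_lt h2 /INR_lt h3]].
    by apply: (noint u v x y) => //; apply/ltP.
  - move=> /sgn cc [/INR_lt h1 [/INR_lt h2 /INR_lt h3]].
    by apply: (noint x y u v) => //; apply/ltP.
  - by move=> /X_inj -> /X_inj ->.
have meet u v x y q : r u v -> r x y -> on_int g u v q -> on_int g x y q ->
    [set u; v] = [set x; y].
  (* [key] needs arcs that run from left to right; an edge running the other way is reversed, with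
     parameter [1 - t]. *)
  have orient a b p : r a b -> on_int g a b p -> exists a' b' t,
     [/\ [set a; b] = [set a'; b'], (X a' < X b')%R, (0 < t < 1)%R & g a' b' t = p].
    move=> rab [t [ht E]]; have := neX _ _ rab.
    case: (Rtotal_order (X a) (X b)) => [lt|[eq|gt]] // _.
      by exists a, b, t.
    exists b, a, (1 - t)%R; split; rewrite 1?setUC //; first lra.
    by rewrite gC -E; congr (g a b _); lra.
  move=> ruv rxy /(orient _ _ _ ruv)[u' [v' [t [E lt ht gt]]]].
  move=> /(orient _ _ _ rxy)[x' [y' [t' [E' lt' ht' gt']]]].
  rewrite E E'; apply: (key u' v' x' y' t t') => //; last by rewrite gt gt'.
  - by rewrite -E rF.
  - by rewrite -E' rF.
exists (fun u => (X u, 0%R)), g; split.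
- split; first by move=> u v [/X_inj].
  move=> u v ruv; have ne := neX _ _ ruv; split.
  + exact: arc_cont.
  + by rewrite /g /arc; split; congr pair; ring.
  + move=> a b _ _ [E _]; apply: (Rmult_eq_reg_r (X v - X u)); [lra|move=> h; apply: ne; lra].
  + move=> t ht w [_].
    have h1 : (0 < t * (1 - t))%R by apply: Rmult_lt_0_compat; lra.
    have h2 : (0 < (X v - X u) * (X v - X u))%R.
      by case: (Rtotal_order (X u) (X v)) => [?|[?|?]] //; nra.
    have := Rmult_lt_0_compat _ _ h1 h2.
    by case: (s1 u v) => ->; lra.
  + by move=> t; rewrite gC.
- split; first by move=> u v x y ruv rxy /eqP ne q q' h1 h2; case: ne; exact: meet h1 h2.
  by move=> u v x y w z ruv rxy _ /eqP ne _ _ q h1 h2 _; case: ne; exact: meet h1 h2.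
- exists set0; split; first by rewrite cards0.
  by move=> u v x y ruv rxy /eqP ne [q [h1 h2]]; case: ne; exact: meet h1 h2.
Qed.

Lemma restrict_planar (e r : rel T) (p : T -> point) (g : T -> T -> R -> point) :
  is_drawing e p g -> simple_drawing e g -> subrel r e ->
  (forall u v x y q, r u v -> r x y -> [set u; v] != [set x; y] ->
     on_int g u v q -> on_int g x y q -> False) -> planar r.
Proof.
move=> [pinj dr] [s1 s2] sub no; exists p, g; split.
- by split=> // u v /sub /dr.
- split=> [u v x y /sub ? /sub ?|]; first exact: s1.
  by move=> u1 v1 u2 v2 u3 v3 /sub ? /sub ? /sub ?; exact: s2.
- exists set0; split; first by rewrite cards0.
  by move=> u v x y ruv rxy ne [q [h1 h2]]; case: (no u v x y q).
Qed.

(** Doubling the positions makes room for the leaf directly after its neighbour [a]. Its edge then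
    joins consecutive positions and interleaves with nothing, on either page. *)
Lemma book_leaf F (v : T) (A : {set T}) :
  #|A| = 2 -> A \in F -> v \in A -> (forall B, B \in F -> v \in B -> B = A) ->
  book (F :\ A) -> book F.
Proof.
move=> A2 AF vA onlyA [pos [c [pinj noint]]].
have [a va EA] := set2_of_mem A2 vA; rewrite eq_sym in va.
pose pos' w := if w == v then (2 * pos a).+1 else 2 * pos w.
exists pos', c; split.
  move=> w w'; rewrite /pos'; case: eqP => [->|]; case: eqP => [->|] //; try lia.
  by move=> _ _ h; apply: pinj; lia.
have split u w : [set u; w] \in F -> [set u; w] = A \/
    [/\ [set u; w] \in F :\ A, pos' u = 2 * pos u & pos' w = 2 * pos w].
  move=> h; case: (eqVneq [set u; w] A) => [|neA]; [by left|right].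
  have nv : v \notin [set u; w] by apply: contra_neqN neA; exact: onlyA.
  move: nv; rewrite !inE negb_or neA h /pos' !(eq_sym v) => /andP[/negPf -> /negPf ->].
  by [].
have pv : pos' v = (2 * pos a).+1 by rewrite /pos' eqxx.
have pa : pos' a = 2 * pos a by rewrite /pos' (negPf va).
clearbody pos'.
move=> u w z y0 /split[Eu|[F1 e1 e2]] /split[Ez|[F2 e3 e4]].
- by move=> _; move: Eu; rewrite EA => /set2_eqP[[-> ->]|[-> ->]]; lia.
- by move=> _; move: Eu; rewrite EA => /set2_eqP[[-> ->]|[-> ->]]; lia.
- by move=> _; move: Ez; rewrite EA => /set2_eqP[[-> ->]|[-> ->]]; lia.
- by move=> ec h1 h2 h3; apply: (noint u w z y0) => //; clear - e1 e2 e3 e4 h1 h2 h3; lia.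
Qed.

(** The new vertex [v] goes next to [a], on the side where the other edge at [a], if
    any, does not separate it from the arc [ab] that the arc [vb] follows. *)
Lemma book_ear F (v a b : T) :
  v != a -> v != b -> a != b -> [set v; a] \in F -> [set v; b] \in F ->
  (forall B, B \in F -> v \in B -> B = [set v; a] \/ B = [set v; b]) ->
  (forall x y, [set a; x] \in F -> [set a; y] \in F ->
     x \notin [set v; b] -> y \notin [set v; b] -> x = y) ->
  book ([set a; b] |: (F :\ [set v; a] :\ [set v; b])) -> book F.
Proof.
move=> va vb ab FA FB only uniqx [pos [c [pinj noint]]].
set F' := _ |: _ in noint.
have abF' : [set a; b] \in F' by rewrite setU11.
pose btw x := (pos a < pos x < pos b) || (pos b < pos x < pos a).
(* Whether the further neighbour of [a], unique by [uniqx], lies between [a] and [b]; false if there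
   is none. *)
have [inside insideE] : exists inside, forall x,
    [set a; x] \in F -> x \notin [set v; b] -> btw x = inside.
  exists [exists x, [&& [set a; x] \in F, x \notin [set v; b] & btw x]] => x xF xn.
  apply/idP/existsP => [h|[y /and3P[yF yn h]]]; first by exists x; rewrite xF xn.
  by rewrite (uniqx x y).
(* Tripling the positions leaves room on both sides of [a]. The offset puts [v] between [a] and [b]
   exactly when [inside] is false. *)
pose delta := if inside (+) (pos a < pos b) then 2 else 0.
pose pos' w := if w == v then 3 * pos a + delta else (3 * pos w).+1.
have pv : pos' v = 3 * pos a + delta by rewrite /pos' eqxx.
have pn w : w != v -> pos' w = (3 * pos w).+1 by rewrite /pos' => /negPf ->.
have pa : pos' a = (3 * pos a).+1 by rewrite pn // eq_sym.
have pb : pos' b = (3 * pos b).+1 by rewrite pn // eq_sym.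
have d02 : delta = 0 \/ delta = 2 by rewrite /delta; case: ifP; auto.
have neqab : pos a <> pos b by move=> /pinj E; rewrite E eqxx in ab.
(* The edge [vb] takes the page of [ab]. The edge [va] joins consecutive positions, so either page
   suits it. *)
pose c' E := if E == [set v; b] then c [set a; b] else c E.
have split u w : [set u; w] \in F -> [\/ [set u; w] = [set v; a], [set u; w] = [set v; b] |
    [/\ [set u; w] \in F', c' [set u; w] = c [set u; w], u != v & w != v]].
  move=> h; case: (eqVneq [set u; w] [set v; a]) => [|nA]; first by constructor 1.
  case: (eqVneq [set u; w] [set v; b]) => [|nB]; first by constructor 2.
  constructor 3.
  have nv : v \notin [set u; w].
    by apply/negP => /(only _ h) [] E; [rewrite E eqxx in nA|rewrite E eqxx in nB].
  rewrite /F' /c' (negPf nB); move: nv nA nB; rewrite !inE negb_or !(eq_sym v).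
  by case/andP=> -> -> -> ->; rewrite h orbT.
have cB : c' [set v; b] = c [set a; b] by rewrite /c' eqxx.
have inE_ x : [set a; x] \in F -> x != v -> x != b -> btw x = inside.
  by move=> h1 h2 h3; apply: insideE => //; rewrite !inE negb_or h2.
have side x : [set a; x] \in F -> x != v -> x != b ->
   (pos a < pos x < pos b) || (pos b < pos x < pos a) = 
     (if pos a < pos b then delta == 0 else delta == 2).
  move=> h1 h2 h3; have := inE_ x h1 h2 h3; rewrite /btw => ->.
  by rewrite /delta; case: (inside); case: (pos a < pos b).
clearbody pos' delta; clear insideE inE_ inside btw.
(* The four ways in which [xy] could interleave with [vb]. If [xy] avoids [a] and [b], then [v] can
   be replaced by [a] and [noint] applies; if it ends at [a], [side] decides. *)
have main x y : [set x; y] \in F -> [set x; y] \in F' -> c [set x; y] = c [set a; b] ->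
    x != v -> y != v ->
    [/\ pos' v < pos' x -> pos' x < pos' b -> pos' b < pos' y -> False,
        pos' b < pos' x -> pos' x < pos' v -> pos' v < pos' y -> False,
        pos' x < pos' v -> pos' v < pos' y -> pos' y < pos' b -> False &
        pos' x < pos' b -> pos' b < pos' y -> pos' y < pos' v -> False].
  move=> xyF xyF' ec xv yv.
  have n1 := noint a b x y abF' xyF' (esym ec).
  have n2 := noint x y a b xyF' abF' ec.
  have baF' : [set b; a] \in F' by rewrite setUC.
  have ec' : c [set x; y] = c [set b; a] by rewrite ec setUC.
  have n3 := noint b a x y baF' xyF' (esym ec').
  have n4 := noint x y b a xyF' baF' ec'.
  have yxF : [set y; x] \in F by rewrite setUC.
  have dx : x = a \/ pos x <> pos a.
    by case: (eqVneq x a) => [|/eqP h]; [left|right=> /pinj].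
  have dy : y = a \/ pos y <> pos a.
    by case: (eqVneq y a) => [|/eqP h]; [left|right=> /pinj].
  rewrite pv pb !pn //.
  case: (eqVneq x b) => [xb|xb]; first by subst x; clear; split; lia.
  case: (eqVneq y b) => [yb|yb]; first by subst y; clear; split; lia.
  case: dx => [xa|xa]; case: dy => [ya|ya].
  - by subst x y; clear; split; lia.
  - subst x; have := side y xyF yv yb; clear - d02 neqab.
    by case: (ltnP (pos a) (pos b)) => ? sd; split; lia.
  - subst y; have := side x yxF xv xb; clear - d02 neqab.
    by case: (ltnP (pos a) (pos b)) => ? sd; split; lia.
  - by split=> h1 h2 h3; [apply: n1|apply: n3|apply: n2|apply: n4];
      clear - d02 h1 h2 h3 xa ya; lia.
exists pos', c'; split.
  move=> w w'; case: (eqVneq w v) => [->|wv]; case: (eqVneq w' v) => [->|wv'] //;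
  rewrite ?pv ?pn //; [clear - d02; lia|clear - d02; lia|].
  by move=> h; apply: pinj; clear - h; lia.
move=> u w x y Fuw Fxy.
case: (split u w Fuw) => [E1|E1|[F1 c1 uv wv]];
  case: (split x y Fxy) => [E2|E2|[F2 c2 xv yv]].
1,2,3: by move/set2_eqP: E1 => [[-> ->]|[-> ->]] _; rewrite pv pa; clear - d02; lia.
1,4: by move/set2_eqP: E2 => [[-> ->]|[-> ->]] _; rewrite pv pa; clear - d02; lia.
- by move/set2_eqP: E1 => [[-> ->]|[-> ->]]; move/set2_eqP: E2 => [[-> ->]|[-> ->]] _;
    rewrite pv pb; clear; lia.
- rewrite E1 cB c2 => ec; have [m1 m2 m3 m4] := main x y Fxy F2 (esym ec) xv yv.
  by move/set2_eqP: E1 => [[-> ->]|[-> ->]].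
- rewrite E2 cB c1 => ec; have [m1 m2 m3 m4] := main u w Fuw F1 ec uv wv.
  by move/set2_eqP: E2 => [[-> ->]|[-> ->]].
- rewrite c1 c2 !pn // => ec h1 h2 h3.
  by apply: (noint u w x y) => //; clear - h1 h2 h3; lia.
Qed.

End Planar.

(** * A computation on graphs with six vertices *)

(** The vertices of a triangulated hexagon 0, ..., 5 with chords 13, 15, 35 on one
    page and 02, 04 together with 24 ([t = true], the octahedron) or 03 on the
    other one.  The chords of the first page are those with two odd ends.  These are
    the two maximal planar graphs on 6 vertices. *)
Definition page_chord (t : bool) (p q : nat) : bool :=
  let x := minn p q in let y := maxn p q in
  [|| y == x.+1, (x == 0) && (y == 5), odd x && odd y |
      [|| (x == 0) && (y == 2), (x == 0) && (y == 4) |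
      if t then (x == 2) && (y == 4) else (x == 0) && (y == 3)]].

(** Labellings of these two triangulations, found by a greedy search, such that
    every graph with at most 8 edges on the vertices 0, ..., 5 is contained in one. *)
Definition cyclic_orders : seq (bool * seq nat) := [::
  (true, [:: 0; 1; 2; 3; 4; 5]); (true, [:: 0; 1; 2; 4; 5; 3]);
  (true, [:: 0; 1; 2; 5; 3; 4]); (true, [:: 0; 1; 3; 2; 4; 5]);
  (true, [:: 0; 1; 4; 3; 2; 5]); (true, [:: 0; 2; 3; 1; 5; 4]);
  (true, [:: 0; 1; 3; 2; 5; 4]); (true, [:: 0; 1; 3; 4; 2; 5]);
  (true, [:: 0; 2; 4; 1; 3; 5]); (false, [:: 0; 1; 2; 3; 5; 4]);
  (false, [:: 1; 3; 0; 2; 4; 5]); (false, [:: 4; 0; 1; 5; 2; 3]);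
  (false, [:: 2; 1; 3; 4; 0; 5]); (false, [:: 0; 3; 4; 2; 1; 5]);
  (false, [:: 1; 0; 2; 4; 5; 3]); (false, [:: 1; 0; 2; 5; 3; 4]);
  (false, [:: 3; 0; 4; 5; 1; 2]); (false, [:: 1; 2; 4; 3; 0; 5]);
  (false, [:: 3; 0; 1; 4; 5; 2]); (false, [:: 0; 2; 3; 1; 4; 5]);
  (false, [:: 2; 0; 1; 4; 3; 5]); (false, [:: 0; 1; 3; 5; 4; 2]);
  (false, [:: 0; 1; 5; 4; 3; 2]); (false, [:: 2; 3; 0; 5; 1; 4]);
  (false, [:: 1; 2; 5; 3; 0; 4]); (false, [:: 3; 0; 2; 5; 4; 1]);
  (false, [:: 0; 1; 5; 2; 4; 3]); (false, [:: 4; 1; 2; 5; 0; 3]);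
  (false, [:: 0; 1; 4; 2; 3; 5]); (false, [:: 2; 1; 0; 3; 5; 4]);
  (false, [:: 0; 1; 3; 4; 2; 5]); (false, [:: 1; 2; 3; 5; 0; 4]);
  (false, [:: 0; 4; 2; 3; 1; 5]); (false, [:: 0; 1; 4; 2; 5; 3]);
  (false, [:: 1; 0; 2; 3; 5; 4]); (false, [:: 1; 2; 0; 4; 3; 5]);
  (false, [:: 2; 0; 5; 4; 1; 3]); (false, [:: 4; 2; 0; 5; 1; 3]);
  (false, [:: 1; 0; 4; 3; 2; 5]); (true, [:: 0; 1; 2; 4; 3; 5]);
  (false, [:: 0; 2; 3; 5; 1; 4]); (false, [:: 0; 2; 5; 1; 3; 4]);
  (false, [:: 0; 2; 1; 3; 5; 4])].

Definition pairs6 : seq (nat * nat) :=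
  [seq (i, j) | i <- iota 0 6, j <- iota i.+1 (5 - i)].

Definition incidence (m : bool * seq nat) : seq bool :=
  [seq page_chord m.1 (index p.1 m.2) (index p.2 m.2) | p <- pairs6].

Fixpoint subbits (bs row : seq bool) : bool :=
  if bs is b :: bs' then (b ==> head false row) && subbits bs' (behead row)
  else true.

(** Every bit sequence of length [n] with at most [k] ones is below some row. *)
Fixpoint covers_upto (n k : nat) (rows : seq (seq bool)) : bool :=
  match n with
  | 0 => ~~ nilp rows
  | n'.+1 =>
      covers_upto n' k [seq behead r | r <- rows] &&
      if k is k'.+1 then
        covers_upto n' k' [seq behead r | r <- rows & head false r]
      else true
  end.

(** A zero bit discards no row; a one bit keeps only the rows that begin with a one, and lowers the
    bound [k]. *)
Lemma covers_uptoP n k rows bs :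
  covers_upto n k rows -> size bs = n -> count idfun bs <= k -> has (subbits bs) rows.
Proof.
elim: n k rows bs => [|n IH] k rows [|b bs] //=.
  by case: rows.
move=> /andP[H0 H1] [sz]; case: b => /= cnt.
  case: k H1 cnt H0 => // k H1 cnt _.
  have := IH _ _ _ H1 sz cnt; rewrite has_map => /hasP[r].
  by rewrite mem_filter => /andP[h rr] /= s; apply/hasP; exists r; rewrite ?h.
have := IH _ _ _ H0 sz cnt; rewrite has_map => /hasP[r rr s].
by apply/hasP; exists r.
Qed.

Lemma subbits_map (A : eqType) (f g : pred A) (s : seq A) :
  subbits [seq f x | x <- s] [seq g x | x <- s] -> {in s, forall x, f x -> g x}.
Proof.
elim: s => //= y s IH /andP[/implyP fg /IH fgs] x.
by rewrite inE => /orP[/eqP -> //|]; exact: fgs.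
Qed.

(** The 15 bits stand for the pairs of six vertices, so the check runs through all labelled graphs
    with at most 8 edges. *)
Lemma cyclic_orders_cover : covers_upto 15 8 [seq incidence m | m <- cyclic_orders].
Proof. by vm_compute. Qed.

Lemma cyclic_ordersP :
  all (fun m => perm_eq m.2 (iota 0 6)) cyclic_orders.
Proof. by vm_compute. Qed.

Lemma page_chord_noncross t p q r s : p < 6 -> q < 6 -> r < 6 -> s < 6 ->
  page_chord t p q -> page_chord t r s -> odd p && odd q = odd r && odd s ->
  p < r -> r < q -> q < s -> False.
Proof.
rewrite /page_chord /minn /maxn.
by case: t; case: p => [|[|[|[|[|[|p]]]]]] //; case: q => [|[|[|[|[|[|q]]]]]] //;
  case: r => [|[|[|[|[|[|r]]]]]] //; case: s => [|[|[|[|[|[|s]]]]]].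
Qed.

Lemma six_labels (b : nat -> nat -> bool) :
  count (fun p => b p.1 p.2) pairs6 <= 8 ->
  exists t s, perm_eq s (iota 0 6) /\
    forall i j, i < j < 6 -> b i j -> page_chord t (index i s) (index j s).
Proof.
move=> cnt.
have := covers_uptoP (bs := [seq b p.1 p.2 | p <- pairs6]) cyclic_orders_cover.
rewrite count_map size_map => /(_ erefl cnt).
rewrite has_map => /hasP[[t s] ms sub]; exists t, s; split.
  by have /allP/(_ _ ms) := cyclic_ordersP.
move=> i j ij bij.
have /(_ (i, j)) := @subbits_map _ (fun p => b p.1 p.2)
  (fun p => page_chord t (index p.1 s) (index p.2 s)) pairs6 sub.
apply=> //.
by apply/allpairsPdep; exists i, j; split=> //; rewrite mem_iota; lia.
Qed.

(** * Book embeddings of graphs with at most 8 edges *)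

Section Small.
Variable T : finType.
Implicit Types (F : {set {set T}}).

Lemma book_support6 F : (forall A, A \in F -> #|A| = 2) ->
  #|F| <= 8 -> #|cover F| <= 6 -> book F.
Proof.
move=> F2 F8 S6.
case: (set_0Vmem F) => [->|[A0 A0F]].
  exists (fun u => nat_of_ord (enum_rank u)), (fun=> true); split; first by move=> u v /ord_inj/enum_rank_inj.
  by move=> u v x y; rewrite inE.
have [x0 _] : exists x, x \in A0 by apply/card_gt0P; rewrite F2.
pose S := enum (cover F).
have szS : size S <= 6 by rewrite /S -cardE.
have uS : uniq S by apply: enum_uniq.
have memS u v : [set u; v] \in F -> (u \in S) /\ (v \in S).
  by move=> h; rewrite !mem_enum; split; apply/bigcupP; exists [set u; v]; rewrite ?set21 ?set22.
(* The bounds make [b] false past the end of [S], where [nth] would return the default [x0]. *)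
pose b i j := [&& i < size S, j < size S & [set nth x0 S i; nth x0 S j] \in F].
have [] := @six_labels b.
  rewrite -size_filter; pose f p := [set nth x0 S p.1; nth x0 S p.2].
  set L := filter _ _; rewrite -(size_map f) (leq_trans _ F8) //.
  rewrite cardE; apply: uniq_leq_size.
    rewrite map_inj_in_uniq ?filter_uniq //.
    move=> [i j] [k l]; rewrite !mem_filter /b /f /=.
    move=> /andP[/and3P[i1 j1 _] ij] /andP[/and3P[k1 l1 _] kl] /set2_eqP.
    have lt p q : (p, q) \in pairs6 -> p < q.
      by case/allpairsPdep=> p' [q' [_ + [-> ->]]]; rewrite mem_iota; lia.
    have := lt _ _ ij; have := lt _ _ kl.
    by move=> ? ? [] [/eqP + /eqP]; rewrite !nth_uniq // => /eqP ? /eqP ?; subst => //; lia.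
  move=> A /mapP[p]; rewrite mem_filter => /andP[/and3P[_ _ h] _] ->.
  by rewrite mem_enum.
move=> t [s [ps bs]].
have szs : size s = 6 by rewrite (perm_size ps).
have mems i : i < 6 -> i \in s by rewrite (perm_mem ps) mem_iota.
(* Vertices off the support carry no edge; their positions, from 6 on, keep [pos] injective. *)
pose pos u := if u \in S then index (index u S) s else 6 + nat_of_ord (enum_rank u).
have posS u : u \in S -> pos u < 6.
  by move=> uin; rewrite /pos uin -szs index_mem mems // (leq_trans _ szS) // index_mem.
exists pos, (fun A : {set T} => [forall u in A, odd (pos u)]); split.
  move=> u v; rewrite /pos.
  case: ifPn => hu; case: ifPn => hv.
  - move=> E; have E' : index u S = index v S.
      by apply: (@index_inj _ 0 s) => //; apply: mems; rewrite (leq_trans _ szS) // index_mem.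
    exact: (index_inj x0 hu hv E').
  - by move=> E; have := mems (index u S); rewrite (leq_trans _ szS) ?index_mem // -index_mem szs; lia.
  - by move=> E; have := mems (index v S); rewrite (leq_trans _ szS) ?index_mem // -index_mem szs; lia.
  - by move=> /addnI/ord_inj/enum_rank_inj.
have chord u v : [set u; v] \in F -> page_chord t (pos u) (pos v).
  move=> h; have [uin vin] := memS _ _ h; rewrite /pos uin vin.
  have iu : index u S < size S by rewrite index_mem.
  have iv : index v S < size S by rewrite index_mem.
  have ne : u != v by have := F2 _ h; rewrite cards2; case: eqP.
  case: (ltngtP (index u S) (index v S)) => cmp.
  - by apply: bs; [lia|rewrite /b iu iv !nth_index].
  - rewrite /page_chord minnC maxnC.
    by apply: bs; [lia|rewrite /b iu iv !nth_index // setUC].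
  - by move: (index_inj x0 uin vin cmp) ne => ->; rewrite eqxx.
have odd2 u v : [forall w in [set u; v], odd (pos w)] = odd (pos u) && odd (pos v).
  apply/forall_inP/andP => [h|[h1 h2] w]; first by rewrite !h ?set21 ?set22.
  by rewrite !inE => /orP[] /eqP ->.
move=> u v x y h1 h2; rewrite !odd2.
have [h3 h4] := memS _ _ h1; have [h5 h6] := memS _ _ h2.
by apply: (@page_chord_noncross t); rewrite ?posS ?chord.
Qed.

Definition incident F (u : T) := [set A in F | u \in A].

Lemma cover_incident F u : (u \in cover F) = (0 < #|incident F u|).
Proof.
apply/bigcupP/card_gt0P => [[A AF uA]|[A]]; first by exists A; rewrite inE AF.
by rewrite inE => /andP[AF uA]; exists A.
Qed.

(* Charge 6 to every vertex of the support, spread over its incident edges; an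
   edge then receives at most 3 + 2, because at most one end has degree 2. *)
Lemma support_bound F : (forall A, A \in F -> #|A| = 2) ->
  (forall u, u \in cover F -> 2 <= #|incident F u|) ->
  (forall u v, [set u; v] \in F -> #|incident F u| = 2 -> #|incident F v| <> 2) ->
  6 * #|cover F| <= 5 * #|F|.
Proof.
move=> F2 deg2 nadj.
pose f u := if #|incident F u| == 2 then 3 else 2.
rewrite mulnC -sum_nat_const.
apply: (@leq_trans (\sum_(u in cover F) \sum_(A in F | u \in A) f u)).
  apply: leq_sum => u uS; rewrite sum_nat_const.
  have -> : #|[pred A in F | u \in A]| = #|incident F u| by rewrite cardsE.
  have := deg2 u uS; rewrite /f; case: ifP => [/eqP -> //|/eqP]; lia.
rewrite (exchange_big_dep (mem F)) /=; last by move=> u A _ /andP[].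
rewrite [X in _ <= X]mulnC -sum_nat_const; apply: leq_sum => A AF.
have /eqP/cards2P[x [y [ne EA]]] := F2 A AF.
rewrite (eq_bigl (mem [set x; y])); last first.
  move=> u; rewrite AF /= EA; apply/andP/idP => [[]|h] //; split=> //.
  by apply/bigcupP; exists A; rewrite // EA.
rewrite big_setU1 ?inE //= big_set1.
have Fxy : [set x; y] \in F by rewrite -EA.
by have := nadj _ _ Fxy; rewrite /f; case: eqP; case: eqP => // h1 h2 /(_ h2).
Qed.

(** Induction on the number of edges, which drops when a leaf is removed or a path [avb] is replaced
    by the edge [ab]. If neither is possible, [support_bound] leaves at most 6 vertices, as 6 times
    their number is at most 40. *)
Lemma book_small F : (forall A, A \in F -> #|A| = 2) -> #|F| <= 8 -> book F.
Proof.
move: {2}#|F|.+1 (ltnSn #|F|) => n; elim: n F => // n IH F Fn F2 F8.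
case: (classic (exists v A, [/\ A \in F, v \in A &
    forall B, B \in F -> v \in B -> B = A])) => [[v [A [AF vA only]]]|noleaf].
  have := cardsD1 A F; rewrite AF add1n => cF.
  apply: (book_leaf (F2 A AF) AF vA only); have lt : #|F :\ A| < #|F| by rewrite cF.
  apply: IH; [exact: leq_trans lt Fn| |exact: leq_trans (ltnW lt) F8].
  by move=> B /setD1P[_ /F2].
pose ear v a b := [/\ v != a, v != b & a != b] /\
  [/\ [set v; a] \in F, [set v; b] \in F,
   (forall B, B \in F -> v \in B -> B = [set v; a] \/ B = [set v; b]) &
   (forall x y, [set a; x] \in F -> [set a; y] \in F ->
     x \notin [set v; b] -> y \notin [set v; b] -> x = y)].
case: (classic (exists v a b, ear v a b)) => [[v [a [b [[va vb ab] [FA FB o u]]]]]|noear].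
  apply: (book_ear va vb ab FA FB o u).
  have neAB : [set v; b] != [set v; a].
    by apply: contraNneq ab => /set2_eqP[[_ ->]|[E1 E2]] //; rewrite E2 -E1.
  have c1 := cardsD1 [set v; a] F.
  have c2 := cardsD1 [set v; b] (F :\ [set v; a]).
  rewrite FA add1n in c1; rewrite in_setD1 neAB FB add1n in c2.
  set F' := _ |: _.
  have lt : #|F'| < #|F|.
    by rewrite c1 c2 cardsU1 ltnS; apply: leq_add (leq_b1 _) (leqnn _).
  apply: IH; [exact: leq_trans lt Fn| |exact: leq_trans (ltnW lt) F8].
  by move=> B /setU1P[->|/setD1P[_ /setD1P[_ /F2]]] //; rewrite cards2 ab.
apply: book_support6 => //.
suff : 6 * #|cover F| <= 5 * #|F| by lia.
apply: support_bound => //.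
  move=> v vF; have := vF; rewrite cover_incident => v0.
  rewrite ltnNge; apply/negP => v1.
  have /cards1P[A EA] : #|incident F v| == 1 by lia.
  have : A \in incident F v by rewrite EA set11.
  rewrite inE => /andP[AF vA]; apply: noleaf; exists v, A; split=> // B BF vB.
  by apply/set1P; rewrite -EA inE BF.
(* Two adjacent vertices of degree 2 give an ear: [b] is the other neighbour of [v], and [a] has
   only one edge besides [va]. *)
move=> v a FA dv da.
have va : v != a by have := F2 _ FA; rewrite cards2; case: eqP.
have [B [BF vB neB]] : exists B, [/\ B \in F, v \in B & B != [set v; a]].
  have := cardsD1 [set v; a] (incident F v).
  rewrite dv inE FA set21 /= => -[] /esym/eqP/cards1P[B EB].
  have : B \in incident F v :\ [set v; a] by rewrite EB set11.
  by rewrite !inE => /and3P[h1 h2 h3]; exists B.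
have [b vb EB] := set2_of_mem (F2 B BF) vB; rewrite EB in BF neB.
have ab : a != b by apply: contraNneq neB => ->.
apply: noear; exists v, a, b; split=> //; split=> //.
  move=> C CF vC; apply/set2P.
  have -> : [set [set v; a]; [set v; b]] = incident F v.
    apply/eqP; rewrite eqEcard dv cards2 eq_sym neB andbT; apply/subsetP => D.
    by rewrite !inE => /orP[] /eqP ->; rewrite ?FA ?BF set21.
  by rewrite inE CF.
move=> x y Fx Fy; rewrite !inE !negb_or => /andP[xv xb] /andP[yv yb].
apply/eqP/negPn/negP => xy.
have : [set [set v; a]; [set a; x]; [set a; y]] \subset incident F a.
  apply/subsetP => D; rewrite !inE => /orP[/orP[]|] /eqP ->.
  - by rewrite FA set22.
  - by rewrite Fx set21.
  - by rewrite Fy set21.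
move/subset_leq_card; rewrite da -setUA cardsU1 cards2 !inE.
have -> : [set a; x] != [set a; y].
  by apply: contraNneq xy => /set2_eqP[[_ ->]|[-> ->]].
have neq z : z != v -> ([set v; a] == [set a; z]) = false.
  move=> zv; apply/eqP => /set2_eqP[[E _]|[E _]]; first by rewrite E eqxx in va.
  by rewrite E eqxx in zv.
by rewrite !neq.
Qed.

End Small.

(** * Small vertex covers of a nonbipartite graph *)

Section CrossingGraph.
Variables (K : finType) (H : {set {set K}}).
Hypothesis H2 : forall P, P \in H -> #|P| = 2.

Definition two_colorable : Prop :=
  exists f : K -> bool, forall a b, [set a; b] \in H -> f a <> f b.

Lemma edge_neq a b : [set a; b] \in H -> a != b.
Proof. by move=> /H2; rewrite cards2; case: eqP. Qed.

(** Edges off [x] and [y] are isolated, and the rest are stars at [x] and [y], possibly joined by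
    [xy]. Neighbours of a centre get the opposite colour; the enumeration order colours an isolated
    edge. *)
Lemma two_colorable_but_two x y :
  (forall u w w', u != x -> u != y -> [set u; w] \in H -> [set u; w'] \in H -> w = w') ->
  two_colorable.
Proof.
move=> uniq.
pose f v := if v == x then true else if v == y then false
  else if [set v; x] \in H then false else if [set v; y] \in H then true
  else [exists w, ([set v; w] \in H) && (enum_rank v < enum_rank w)].
have fx a b : [set a; b] \in H -> a = x -> f a <> f b.
  move=> ab ax; subst a; have ne := edge_neq ab.
  by rewrite /f eqxx eq_sym (negPf ne) setUC ab; case: eqP.
have fy a b : [set a; b] \in H -> a != x -> b != x -> a = y -> f a <> f b.
  move=> ab ax bx ay; subst a; have ne := edge_neq ab.
  rewrite /f (negPf ax) (negPf bx) eqxx eq_sym (negPf ne).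
  have ba : [set b; y] \in H by rewrite setUC.
  rewrite ba; case: ifP => // bxH.
  have := uniq b x y bx; rewrite eq_sym => /(_ ne bxH ba) E.
  by rewrite E eqxx in ax.
exists f => a b ab; have ba : [set b; a] \in H by rewrite setUC.
case: (eqVneq a x) => [|ax]; first exact: fx.
case: (eqVneq b x) => [bx|bx]; first by apply: not_eq_sym; exact: fx.
case: (eqVneq a y) => [|ay]; first exact: fy.
case: (eqVneq b y) => [bY|bY]; first by apply: not_eq_sym; exact: fy.
have ua w : [set a; w] \in H -> w = b by move=> h; exact: uniq h ab.
have ub w : [set b; w] \in H -> w = a by move=> h; exact: uniq h ba.
have no z w z' : z' != w -> (forall w', [set z; w'] \in H -> w' = z') ->
    ([set z; w] \in H) = false.
  by move=> ne un; apply/negP => /un E; rewrite E eqxx in ne.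
rewrite /f (negPf ax) (negPf bx) (negPf ay) (negPf bY).
rewrite (no a x b) // (no a y b) // (no b x a) // (no b y a) //.
have ea : [exists w, ([set a; w] \in H) && (enum_rank a < enum_rank w)] =
    (enum_rank a < enum_rank b).
  by apply/existsP/idP => [[w /andP[/ua -> //]]|h]; exists b; rewrite ab.
have eb : [exists w, ([set b; w] \in H) && (enum_rank b < enum_rank w)] =
    (enum_rank b < enum_rank a).
  by apply/existsP/idP => [[w /andP[/ub -> //]]|h]; exists a; rewrite ba.
rewrite ea eb; have : enum_rank a <> enum_rank b :> nat.
  by move=> /ord_inj/enum_rank_inj E; have := edge_neq ab; rewrite E eqxx.
by case: ltngtP.
Qed.

Lemma high_degree x y : ~ two_colorable ->
  exists u, [/\ u != x, u != y & 1 < #|incident H u|].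
Proof.
move=> nc; apply: NNPP => no; apply: nc; apply: (@two_colorable_but_two x y).
move=> u w w' ux uy h h'; apply: NNPP => ww'; apply: no; exists u; split=> //.
apply/card_gt1P; exists [set u; w], [set u; w']; rewrite !inE h h' !eqxx; split=> //.
apply/eqP => /set2_eqP[[_ //]|[E1 E2]].
by have := edge_neq h; rewrite E2 eqxx.
Qed.

Definition hit (X : {set K}) := [set P in H | ~~ [disjoint X & P]].

Lemma mem_hit (X : {set K}) P x : P \in H -> x \in X -> x \in P -> P \in hit X.
Proof. by move=> PH xX xP; rewrite inE PH; apply/pred0Pn; exists x; rewrite !inE xX. Qed.

Definition hitting_set (X : {set K}) (h : {set K} -> K) :=
  X :|: [set h P | P in H & [disjoint X & P]].

(** Each edge missed by [X] costs at most one further vertex. *)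
Lemma hitting_set_card (X : {set K}) h : #|hitting_set X h| + #|hit X| <= #|X| + #|H|.
Proof.
have -> : #|H| = #|[set P in H | [disjoint X & P]]| + #|hit X|.
  rewrite -(cardsID [set P : {set K} | [disjoint X & P]] H); congr (_ + _); apply: eq_card => P;
  by rewrite !inE // andbC.
rewrite addnA leq_add2r /hitting_set.
apply: leq_trans (leq_card_setU _ _) _; rewrite leq_add2l.
have -> : [set h P | P in H & [disjoint X & P]] = h @: [set P in H | [disjoint X & P]].
  by apply/setP => z; apply/imsetP/imsetP => -[P hP ->]; exists P; rewrite // inE in hP *.
exact: leq_imset_card.
Qed.

Lemma hitting_setP (X : {set K}) h P : (forall Q, Q \in H -> h Q \in Q) -> P \in H ->
  exists2 A, A \in P & A \in hitting_set X h.
Proof.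
move=> hh PH; case: (boolP [disjoint X & P]) => [d|/pred0Pn[A /andP[AX AP]]].
  exists (h P); first exact: hh.
  by rewrite inE; apply/orP; right; apply/imsetP; exists P; rewrite // inE PH.
by exists A => //; rewrite inE; apply/orP; left.
Qed.

Lemma hitting_set_sub (X : {set K}) h : (forall Q, Q \in H -> h Q \in Q) -> X \subset cover H ->
  hitting_set X h \subset cover H.
Proof.
move=> hh XH; rewrite subUset XH; apply/subsetP => A /imsetP[P].
by rewrite inE => /andP[PH _] ->; apply/bigcupP; exists P => //; exact: hh.
Qed.

Definition triangle_edges (a b c : K) := [set [set a; b]; [set a; c]; [set b; c]].

Lemma triangleP a b c P : P \in triangle_edges a b c ->
  [\/ P = [set a; b], P = [set a; c] | P = [set b; c]].
Proof. by rewrite !inE => /orP[/orP[]|] /eqP; [constructor 1|constructor 2|constructor 3]. Qed.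

Lemma card_triangle a b c : a != b -> a != c -> b != c -> #|triangle_edges a b c| = 3.
Proof.
move=> ab ac bc; have [/negPf n1 /negPf n2 n3] := triangle_neq ab ac bc.
by rewrite /triangle_edges -setUA cardsU1 cards2 !inE n1 n2 n3.
Qed.

(** The three vertices of degree at least 2 given by [high_degree] are pairwise
    adjacent and have degree 2, as otherwise one or two vertices hit enough edges. *)
Lemma odd_crossing_graph : #|H| <= 10 -> ~ two_colorable ->
  (exists2 X : {set K}, X \subset cover H & #|X| + #|H| <= 8 + #|hit X|) \/
  exists a b c, [/\ a != b, a != c & b != c] /\
    [/\ #|H| = 10, triangle_edges a b c \subset H &
    forall u P Q, P \in H -> P \notin triangle_edges a b c -> Q \in H ->
      u \in P -> u \in Q -> P = Q].
Proof.
move=> H10 nc; apply: NNPP => /not_or_and[noX no3].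
have sub1 u : 1 < #|incident H u| -> u \in cover H by rewrite cover_incident; lia.
(* A vertex of degree 3 would suffice alone: [1 + 10 <= 8 + 3]. *)
have deg2 u : #|incident H u| <= 2.
  rewrite leqNgt; apply/negP => d; apply: noX; exists [set u].
    by rewrite sub1set sub1 // ltnW.
  have : incident H u \subset hit [set u].
    by apply/subsetP => P; rewrite inE => /andP[PH uP]; apply: (@mem_hit _ _ u); rewrite ?set11.
  by move/subset_leq_card; rewrite cards1; lia.
(* Two nonadjacent vertices of degree at least 2 hit at least 4 edges, and [2 + 10 <= 8 + 4]. *)
have adj u v : u != v -> 1 < #|incident H u| -> 1 < #|incident H v| -> [set u; v] \in H.
  move=> uv du dv; apply/negPn/negP => nuv; apply: noX; exists [set u; v].
    by apply/subsetP => w /set2P[] ->; exact: sub1.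
  have : incident H u :|: incident H v \subset hit [set u; v].
    apply/subsetP => P /setUP[]; rewrite inE => /andP[PH uP].
      by apply: (@mem_hit _ _ u); rewrite ?set21.
    by apply: (@mem_hit _ _ v); rewrite ?set22.
  move/subset_leq_card; rewrite cardsU cards2 uv.
  have -> : incident H u :&: incident H v = set0.
    apply/setP => P; rewrite !inE; apply/negP => /andP[/andP[PH uP] /andP[_ vP]].
    have [w uw EP] := set2_of_mem (H2 PH) uP.
    move: vP; rewrite EP !inE eq_sym (negPf uv) => /eqP E.
    by rewrite E -EP PH in nuv.
  by rewrite cards0; lia.
have [x0 _] : exists u : K, True.
  apply: NNPP => no; apply: nc; exists (fun=> true) => a; by case: no; exists a.
have [a [_ _ da]] := high_degree x0 x0 nc.
have [b [ba _ db]] := high_degree a a nc.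
have [c [ca cb dc]] := high_degree a b nc.
rewrite eq_sym in ba; rewrite eq_sym in ca; rewrite eq_sym in cb.
have ab := adj _ _ ba da db; have ac := adj _ _ ca da dc; have bc := adj _ _ cb db dc.
have c3 := card_triangle ba ca cb.
have three w P Q R : P \in incident H w -> Q \in incident H w -> R \in incident H w ->
    P != Q -> Q != R -> R != P -> False.
  move=> h1 h2 h3 n1 n2 n3; have := deg2 w; rewrite leqNgt => /negP; apply.
  by apply/card_gt2P; exists P, Q, R.
have inc u v : [set u; v] \in H -> [set u; v] \in incident H u /\ [set u; v] \in incident H v.
  by move=> h; rewrite !inE h !eqxx orbT.
have [abi abj] := inc _ _ ab; have [aci acj] := inc _ _ ac; have [bci bcj] := inc _ _ bc.
have [n1 n2 n3] := triangle_neq ba ca cb.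
have triH : triangle_edges a b c \subset H.
  by apply/subsetP => P /triangleP[] ->.
apply: no3; exists a, b, c; split=> //; split=> //.
  (* With at most 9 edges, [a] and [b] would suffice, as they hit the triangle: [2 + 9 <= 8 + 3]. *)
  apply/eqP; rewrite eqn_leq H10 leqNgt; apply/negP => H9.
  apply: noX; exists [set a; b].
    by apply/subsetP => w /set2P[] ->; exact: sub1.
  have : triangle_edges a b c \subset hit [set a; b].
    apply/subsetP => P /triangleP[] ->.
    - by apply: (@mem_hit _ _ a); rewrite ?set21.
    - by apply: (@mem_hit _ _ a); rewrite ?set21.
    - by apply: (@mem_hit _ _ b); rewrite ?set21 ?set22.
  move/subset_leq_card; rewrite c3 cards2 ba => h3.
  by apply: (@leq_trans (8 + 3)); [rewrite (leq_add2l 2 _ 9)|rewrite leq_add2l].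
(* If [P] and [Q] differ, [u] has degree at least 2. Either [u] is on the triangle and [P] is a
   third edge there, or [adj] joins [u] to [a], which gets a third edge. *)
move=> u P Q PH Ptri QH uP uQ; apply: NNPP => PQ.
have Pi : P \in incident H u by rewrite inE PH.
move: Ptri; rewrite !inE !negb_or => /andP[/andP[p1 p2] p3].
have du : 1 < #|incident H u|.
  by apply/card_gt1P; exists P, Q; split=> //; [rewrite inE QH|exact/eqP].
case: (eqVneq u a) => [ua|ua].
  by subst u; apply: (three a P [set a; b] [set a; c]); rewrite // eq_sym.
case: (eqVneq u b) => [ub|ub].
  by subst u; apply: (three b P [set a; b] [set b; c]); rewrite // eq_sym.
case: (eqVneq u c) => [uc|uc].
  by subst u; apply: (three c P [set a; c] [set b; c]); rewrite // eq_sym.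
have [_ uai] := inc _ _ (adj _ _ ua du da).
apply: (three a [set a; b] [set a; c] [set u; a]) => //.
  by apply/eqP => /set2_eqP[[E _]|[_ E]]; [rewrite E eqxx in ua|rewrite E eqxx in uc].
by apply/eqP => /set2_eqP[[E _]|[E _]]; [rewrite E eqxx in ua|rewrite E eqxx in ub].
Qed.

End CrossingGraph.

(** * Vertex covers of the crossing graph that have a book embedding *)

Section Crossings.
Variables (T : finType) (H : {set {set {set T}}}).
Hypothesis H2 : forall P, P \in H -> #|P| = 2.
Hypothesis edge2 : forall A, A \in cover H -> #|A| = 2.

Lemma mem_cover_edge (P : {set {set T}}) (A : {set T}) :
  P \in H -> A \in P -> A \in cover H.
Proof. by move=> PH AP; apply/bigcupP; exists P. Qed.

(** The crossing pairs both of whose edges end at [u]: any cover of H must contain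
    an edge at [u] from each of them. *)
Definition common (u : T) := [set P in H | [forall A in P, u \in A]].

(** If both edges of [P] contained two vertices [u] and [v], both would equal [[set u; v]]. *)
Lemma common_le1 (P : {set {set T}}) : P \in H -> #|[set u | P \in common u]| <= 1.
Proof.
move=> PH; apply/card_le1_eqP => u v; rewrite !inE PH /=.
have /eqP/cards2P[A [B [AB EP]]] := H2 PH.
move=> /forall_inP hu /forall_inP hv; apply/eqP/negPn/negP => uv.
have full D : D \in P -> D = [set u; v].
  move=> DP; apply/esym/eqP; rewrite eqEcard cards2 eq_sym uv edge2 ?leqnn ?andbT; last exact: mem_cover_edge DP.
  by apply/subsetP => w /set2P[] ->; [exact: hu|exact: hv].
have AP : A \in P by rewrite EP set21.
have BP : B \in P by rewrite EP set22.
by case/eqP: AB; rewrite (full A AP) (full B BP).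
Qed.

Lemma card_edges_le (S : {set {set T}}) : (forall A, A \in S -> #|A| = 2) ->
  #|S| <= 'C(#|cover S|, 2).
Proof.
move=> S2; rewrite -cards_draws; apply: subset_leq_card; apply/subsetP => A AS.
rewrite inE S2 // eqxx andbT; apply/subsetP => u uA.
by apply/bigcupP; exists A.
Qed.

(** The 7 isolated edges of H involve 14 edges of G, hence at least 6 vertices of G,
    whereas each of the 10 crossing pairs has at most one common vertex. *)
Lemma exists_leaf_vertex (tri : {set {set {set T}}}) :
  #|H| = 10 -> #|tri| = 3 -> tri \subset H ->
  (forall u P Q, P \in H -> P \notin tri -> Q \in H -> u \in P -> u \in Q -> P = Q) ->
  exists u, u \in cover (cover (H :\: tri)) /\ #|common u| <= 1.
Proof.
move=> H10 t3 tH only.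
have M7 : #|H :\: tri| = 7 by rewrite cardsD (setIidPr tH) H10 t3.
have M14 : #|cover (H :\: tri)| = 14.
  have /eqP <- : trivIset (H :\: tri).
    apply/trivIsetP => P Q; rewrite !inE => /andP[nP PH] /andP[_ QH] PQ.
    apply/pred0P => u /=; apply/negP => /andP[uP uQ].
    by case/eqP: PQ; exact: only uP uQ.
  rewrite (eq_bigr (fun=> 2)); first by rewrite sum_nat_const M7.
  by move=> P; rewrite inE => /andP[_ /H2].
(* Five vertices span at most 10 edges, fewer than 14. *)
have W6 : 6 <= #|cover (cover (H :\: tri))|.
  rewrite ltnNge; apply/negP => W5.
  have : #|cover (H :\: tri)| <= 'C(5, 2).
    apply: leq_trans (leq_bin2l _ W5); apply: card_edges_le => A /bigcupP[P].
    by rewrite inE => /andP[_ PH] AP; apply: edge2; exact: mem_cover_edge AP.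
  by rewrite M14.
(* Otherwise each of these 6 or more vertices is common to at least two crossing pairs, which makes
   12 incidences; counted by pairs there are at most 10. *)
apply: NNPP => no.
have : \sum_(u in cover (cover (H :\: tri))) 2 <= \sum_(u in cover (cover (H :\: tri))) #|common u|.
  apply: leq_sum => u uW; rewrite ltnNge; apply/negP => c1.
  by apply: no; exists u.
rewrite sum_nat_const.
have : \sum_(u in cover (cover (H :\: tri))) #|common u| <= \sum_(P in H) 1.
  apply: (@leq_trans (\sum_u #|common u|)).
    by rewrite [leqRHS](bigID (mem (cover (cover (H :\: tri))))) leq_addr.
  under eq_bigr do rewrite -sum1_card.
  rewrite (exchange_big_dep (mem H)) /=; last by move=> u P _; rewrite inE => /andP[].
  apply: leq_sum => P PH; rewrite sum1_card.
  by apply: leq_trans (common_le1 PH); rewrite cardsE.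
by rewrite sum1_card H10; lia.
Qed.

(** [X] is completed by edges avoiding [u]: a pair without such an edge is in [common u], so it
    contains [f0] and is hit already. Thus [u] is a leaf with edge [f0], and at most 8 other edges
    remain. *)
Lemma book_hitting_set (X : {set {set T}}) (u : T) (f0 : {set T}) :
  f0 \in X -> X \subset cover H -> u \in f0 ->
  (forall A, A \in X -> u \in A -> A = f0) ->
  (forall P, P \in common u -> f0 \in P) ->
  #|X| + #|H| <= 9 + #|hit H X| ->
  exists2 F : {set {set T}}, book F &
    forall P, P \in H -> exists2 A, A \in P & A \in F.
Proof.
move=> f0X XH uf0 Xu cu cX.
pose h (P : {set {set T}}) := 
  if [pick A in P | u \notin A] is Some A then A else
  if [pick A in P] is Some A then A else set0.
have hP P : P \in H -> h P \in P.
  move=> PH; rewrite /h; case: pickP => [A /andP[] //|_]; case: pickP => [A //|no].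
  by have := H2 PH; rewrite eq_card0.
have hu P : P \in H -> P \notin common u -> u \notin h P.
  move=> PH; rewrite inE PH /= negb_forall => /existsP[A]; rewrite negb_imply => AP.
  by rewrite /h; case: pickP => [B /andP[] //|/(_ A)]; rewrite AP.
have sub := hitting_set_sub hP XH.
have c9 : #|hitting_set H X h| <= 9.
  by have := hitting_set_card H X h; lia.
exists (hitting_set H X h); last by move=> P; exact: hitting_setP.
have F2 A : A \in hitting_set H X h -> #|A| = 2 by move=> /(subsetP sub)/edge2.
have f0F : f0 \in hitting_set H X h by rewrite inE f0X.
apply: (book_leaf (F2 _ f0F) f0F uf0).
  move=> B /setUP[BX uB|/imsetP[P]]; first exact: Xu.
  rewrite inE => /andP[PH dis] -> uh; exfalso.
  case: (boolP (P \in common u)) => [/cu f0P|/(hu P PH)]; last by rewrite uh.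
  by move/pred0P/(_ f0): dis; rewrite /= f0X f0P.
apply: book_small; first by move=> B /setD1P[_ /F2].
by have := cardsD1 f0 (hitting_set H X h); rewrite f0F add1n => cF; rewrite -ltnS -cF.
Qed.

(** At most one of [a], [b], [c] contains [u], and any two vertices of a triangle cover its
    edges. *)
Lemma triangle_two_avoid (a b c : {set T}) (u : T) :
  a != b -> a != c -> b != c -> triangle_edges a b c \subset H ->
  (forall P, P \in triangle_edges a b c -> P \notin common u) ->
  exists p q : {set T}, [/\ u \notin p, u \notin q, p \in cover H, q \in cover H &
    triangle_edges a b c \subset hit H [set p; q]].
Proof.
move=> ab ac bc tH nc.
have abH : [set a; b] \in H by apply: (subsetP tH); rewrite !inE eqxx.
have acH : [set a; c] \in H by apply: (subsetP tH); rewrite !inE eqxx orbT.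
have bcH : [set b; c] \in H by apply: (subsetP tH); rewrite !inE eqxx orbT.
have av x y : [set x; y] \in triangle_edges a b c -> ~~ ((u \in x) && (u \in y)).
  move=> xy; apply: contra (nc _ xy) => /andP[ux uy]; rewrite inE (subsetP tH) //=.
  by apply/forall_inP => A /set2P[] ->.
have nab := av a b; have nac := av a c; have nbc := av b c.
rewrite !inE !eqxx ?orbT /= in nab nac nbc.
have {}nab := nab isT; have {}nac := nac isT; have {}nbc := nbc isT.
have ha := mem_cover_edge abH (set21 a b).
have hb := mem_cover_edge abH (set22 a b).
have hc := mem_cover_edge acH (set22 a c).
have hits p q : (forall P, P \in triangle_edges a b c -> (p \in P) || (q \in P)) ->
    triangle_edges a b c \subset hit H [set p; q].
  move=> h; apply/subsetP => P Pt; have PH := subsetP tH _ Pt.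
  by case/orP: (h P Pt); apply: mem_hit; rewrite ?set21 ?set22.
case: (boolP (u \in a)) => ua; last case: (boolP (u \in b)) => ub.
- rewrite ua /= in nab nac; exists b, c; split=> //.
  by apply: hits => P /triangleP[] ->; rewrite !inE !eqxx ?orbT.
- rewrite ub /= in nbc; exists a, c; split=> //.
  by apply: hits => P /triangleP[] ->; rewrite !inE !eqxx ?orbT.
- exists a, b; split=> //.
  by apply: hits => P /triangleP[] ->; rewrite !inE !eqxx ?orbT.
Qed.

Lemma book_cover : #|H| <= 10 -> ~ two_colorable H ->
  exists2 F : {set {set T}}, book F &
    forall P, P \in H -> exists2 A, A \in P & A \in F.
Proof.
move=> H10 nc; case: (odd_crossing_graph H2 H10 nc) => [[X XH cX]|].
  pose h (P : {set {set T}}) := if [pick A in P] is Some A then A else set0.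
  have hP P : P \in H -> h P \in P.
    move=> PH; rewrite /h; case: pickP => [A //|no].
    by have := H2 PH; rewrite eq_card0.
  have sub := hitting_set_sub hP XH.
  exists (hitting_set H X h); last by move=> P; exact: hitting_setP.
  apply: book_small => [A /(subsetP sub)/edge2 //|].
  by have := hitting_set_card H X h; lia.
move=> [a [b [c [[ab ac bc] [cH tH only]]]]].
have t3 := card_triangle ab ac bc.
have [u [uW cu]] := exists_leaf_vertex cH t3 tH only.
(* If a triangle pair is common at [u], it is the only pair common there, and its member [f0] lies
   in two triangle pairs: [1 + 10 <= 9 + 2]. *)
case: (classic (exists2 P, P \in triangle_edges a b c & P \in common u)) => [[P Pt Pc]|nct].
  have PH := subsetP tH _ Pt.
  have [f0 f0P others] : exists2 f0, f0 \in P & 2 <= #|hit H [set f0]|.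
    have two x Q R : Q \in H -> R \in H -> x \in Q -> x \in R -> Q != R -> 2 <= #|hit H [set x]|.
      move=> QH RH xQ xR QR; apply/card_gt1P; exists Q, R; split=> //.
        by apply: (mem_hit (x := x)); rewrite ?set11.
      by apply: (mem_hit (x := x)); rewrite ?set11.
    have abH : [set a; b] \in H by apply: (subsetP tH); rewrite !inE eqxx.
    have acH : [set a; c] \in H by apply: (subsetP tH); rewrite !inE eqxx orbT.
    have bcH : [set b; c] \in H by apply: (subsetP tH); rewrite !inE eqxx orbT.
    have [n1 n2 _] := triangle_neq ab ac bc.
    case/triangleP: Pt => ->.
    - by exists a; rewrite ?set21 //; apply: (two a _ _ abH acH); rewrite ?set21.
    - by exists a; rewrite ?set21 //; apply: (two a _ _ abH acH); rewrite ?set21.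
    - by exists b; rewrite ?set21 //; apply: (two b _ _ abH bcH); rewrite ?set21 ?set22.
  have uf0 : u \in f0 by move: Pc; rewrite inE => /andP[_ /forall_inP]; apply.
  apply: (@book_hitting_set [set f0] u f0) => //.
  - exact: set11.
  - by rewrite sub1set; exact: mem_cover_edge f0P.
  - by move=> A /set1P.
  - by move=> Q Qc; move/card_le1_eqP: cu => /(_ _ _ Qc Pc) <-.
  - by rewrite cards1 cH (leq_add2l 9 2).
(* [f0] comes from the one pair in [common u] or, if there is none, from an isolated pair with an
   edge at [u]. *)
have [P0 [f0 [P0H P0t f0P uf0 cP]]] : exists P0 f0, [/\ P0 \in H, P0 \notin triangle_edges a b c,
    f0 \in P0, u \in f0 & forall P, P \in common u -> f0 \in P].
  case: (set_0Vmem (common u)) => [c0|[P Pc]].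
    have /bigcupP[f0 /bigcupP[P]] := uW; rewrite inE => /andP[Pt PH] f0P uf0.
    by exists P, f0; split=> // Q; rewrite c0 inE.
  have := Pc; rewrite inE => /andP[PH /forall_inP Pu].
  have /card_gt0P[f0 f0P] : 0 < #|P| by rewrite H2.
  exists P, f0; split=> //; first by apply/negP => Pt; apply: nct; exists P.
    exact: Pu.
  by move=> Q Qc; move/card_le1_eqP: cu => /(_ _ _ Qc Pc) <-.
have [|p [q [up uq pH qH tpq]]] := triangle_two_avoid (u := u) ab ac bc tH.
  by move=> P Pt; apply/negP => Pc; apply: nct; exists P.
apply: (@book_hitting_set (f0 |: [set p; q]) u f0) => //.
- exact: setU11.
- by rewrite subUset sub1set (mem_cover_edge P0H f0P) subUset !sub1set pH qH.
- by move=> A /setU1P[//|/set2P[] ->]; rewrite ?(negPf up) ?(negPf uq).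
(* The edges [f0], [p], [q] hit [P0] and the three triangle pairs: [3 + 10 <= 9 + 4]. *)
- have : P0 |: triangle_edges a b c \subset hit H (f0 |: [set p; q]).
    apply/subsetP => P /setU1P[->|/(subsetP tpq)].
      by apply: (mem_hit (x := f0)) => //; exact: setU11.
    rewrite inE => /andP[PH /pred0Pn[x /andP[xpq xP]]].
    by apply: (mem_hit (x := x)) => //; apply/setU1P; right.
  move/subset_leq_card; rewrite cardsU1 P0t t3 cH => h4.
  have h3 : #|f0 |: [set p; q]| <= 3.
    by rewrite cardsU1 cards2; apply: (@leq_add _ _ 1 2); rewrite ?ltnS leq_b1.
  by apply: leq_trans (leq_add h3 (leqnn 10)) _; rewrite (leq_add2l 9 4).
Qed.

End Crossings.

Theorem theorem4 (T : finType) (e : rel T) :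
  symmetric e -> irreflexive e -> cr_le e 10 -> biplanar e.
Proof.
move=> sym irr [p [g [dr sd [C [C10 crossC]]]]].
(* [C] may have members other than pairs of two-element sets; these are discarded. *)
pose H := [set P in C | (#|P| == 2) && [forall A in P, #|A| == 2]].
have H10 : #|H| <= 10.
  by apply: leq_trans C10; apply: subset_leq_card; apply/subsetP => P; rewrite inE => /andP[].
have H2 P : P \in H -> #|P| = 2 by rewrite inE => /and3P[_ /eqP].
have edge2 A : A \in cover H -> #|A| = 2.
  by case/bigcupP=> P; rewrite inE => /and3P[_ _ /forall_inP h] /h /eqP.
have e2 u v : e u v -> #|[set u; v]| = 2.
  by move=> uv; rewrite cards2; case: eqP => // E; rewrite E irr in uv.
have crossH u v x y q : e u v -> e x y -> [set u; v] != [set x; y] ->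
    on_int g u v q -> on_int g x y q -> [set [set u; v]; [set x; y]] \in H.
  move=> uv xy ne h1 h2; rewrite inE crossC //=; last by exists q.
  by rewrite cards2 ne; apply/forall_inP => A /set2P[] ->; rewrite e2.
case: (classic (two_colorable H)) => [[f fP]|nc].
  exists (fun u v => f [set u; v]); split; first by move=> u v; rewrite setUC.
  split; apply: (restrict_planar dr sd); try by move=> u v /andP[].
    move=> u v x y q /andP[uv cuv] /andP[xy cxy] ne h1 h2.
    by apply: (fP _ _ (crossH _ _ _ _ _ uv xy ne h1 h2)); rewrite cuv cxy.
  move=> u v x y q /andP[uv cuv] /andP[xy cxy] ne h1 h2.
  by apply: (fP _ _ (crossH _ _ _ _ _ uv xy ne h1 h2)); rewrite (negPf cuv) (negPf cxy).
have [F bF hitF] := book_cover H2 edge2 H10 nc.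
(* Edges outside [F] keep their curves; those in [F] are redrawn from the book embedding. *)
exists (fun u v => [set u; v] \notin F); split; first by move=> u v; rewrite setUC.
split.
  apply: (restrict_planar dr sd); first by move=> u v /andP[].
  move=> u v x y q /andP[uv cuv] /andP[xy cxy] ne h1 h2.
  have [A /set2P[] -> AF] := hitF _ (crossH _ _ _ _ _ uv xy ne h1 h2).
    by rewrite AF in cuv.
  by rewrite AF in cxy.
apply: (book_planar (F := F)) => //; first by move=> u; rewrite /= irr.
by move=> u v /andP[_]; rewrite negbK.
Qed.
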